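(* Let $f:\mathbb{R}^m\to\mathbb{R}$ be convex, differentiable and coercive with $L$-Lipschitz continuous gradient ($L>0$) and $\min f>-\infty$. Let $(\beta_k)_{k\ge 0}$ be non-increasing with $0<\inf_k\beta_k\le\beta_k\le\beta_0<1$, let $0<c<1$ be fixed, let $\gamma_k=\frac{2(1-\beta_k)c}{L}$, and let $(x^k)_{k\ge 0}$ be generated by the Heavy-ball method $x^{k+1}=x^k-\gamma_k\nabla f(x^k)+\beta_k(x^k-x^{k-1})$. Then for all $k\ge 1$, $$f(x^k)-\min f\le\frac{4R\cdot\sup_k\{\varepsilon_k\}}{k},$$ where $$R:=\sup_{k\ge 0}\ \sup_{x^*\in\arg\min f}\|x^k-x^*\|^2,\qquad \varepsilon_k:=\frac{4c\,\delta_k^2}{(1-c)L}+\frac{4c}{(1-c)L\gamma_k^2},\qquad \delta_k:=\frac{\beta_k}{2\gamma_k}+\frac12\left(\frac{1-\beta_k}{\gamma_k}-\frac L2\right).$$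
   Context: $\|\cdot\|$ is the Euclidean norm. $f$ is coercive if $f(x)\to+\infty$ as $\|x\|\to+\infty$. The Heavy-ball iteration is run for all $k\ge 0$ from arbitrary initial points $x^{-1},x^0\in\mathbb{R}^m$. *)

(* Defs.v *)
(* R^m is 'rV[R]_m over an arbitrary R : realType; m = 0 is allowed. *)
From HB Require Import structures.
From mathcomp Require Export all_boot all_order all_algebra.
From mathcomp Require Export all_classical all_reals all_analysis.
Export Order.TTheory GRing.Theory Num.Theory.
Export numFieldNormedType.Exports.

Set Implicit Arguments.
Unset Strict Implicit.
Unset Printing Implicit Defensive.


Local Open Scope classical_set_scope.
Local Open Scope ring_scope.

Section HeavyBall.
Context {R : realType} {m : nat}.
Implicit Types (f : 'rV[R]_m -> R) (x : nat -> 'rV[R]_m).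
Implicit Types (beta gamma : nat -> R) (c L : R) (k : nat).

(* The library norm `|v| on 'rV[R]_m is the sup norm. It induces the usual
   topology and hence the usual notion of differentiability, but every
   quantitative norm below has to be Euclidean. *)
Definition enorm (v : 'rV[R]_m) : R := Num.sqrt (\sum_i v 0 i ^+ 2).

(* Partial derivatives; meaningful only where f is differentiable. *)
Definition grad f (v : 'rV[R]_m) : 'rV[R]_m :=
  \row_i 'D_(delta_mx 0 i) f v.

Definition lipschitz_grad L f :=
  forall u v, enorm (grad f u - grad f v) <= L * enorm (u - v).

Definition coercive f :=
  forall A : R, exists B : R, forall v, B < enorm v -> A < f v.

Definition argmin f : set 'rV[R]_m := [set v | forall u, f v <= f u].

(* Extended-real valued, so that minval f > -oo is a genuine condition. *)
Definition minval f : \bar R := ereal_inf [set (f v)%:E | v in [set: 'rV[R]_m]].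

(* The point preceding x k, where xm1 is the point of index -1. *)
Definition prev (xm1 : 'rV[R]_m) x k : 'rV[R]_m :=
  if k is k'.+1 then x k' else xm1.

Definition heavy_ball f gamma beta (xm1 : 'rV[R]_m) x :=
  forall k, x k.+1 =
    x k - gamma k *: grad f (x k) + beta k *: (x k - prev xm1 x k).

Definition stepsize c L beta k : R := 2 * (1 - beta k) * c / L.

Definition hb_delta L gamma beta k : R :=
  beta k / (2 * gamma k) + 2^-1 * ((1 - beta k) / gamma k - L / 2).

Definition hb_eps c L gamma beta k : R :=
  4 * c * hb_delta L gamma beta k ^+ 2 / ((1 - c) * L) +
  4 * c / ((1 - c) * L * gamma k ^+ 2).

Definition hb_radius f x : \bar R :=
  ereal_sup [set ereal_sup [set (enorm (x k - xs) ^+ 2)%:E | xs in argmin f]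
            | k in [set: nat]].

Definition hb_sup_eps c L gamma beta : \bar R :=
  ereal_sup [set (hb_eps c L gamma beta k)%:E | k in [set: nat]].

End HeavyBall.

(* Main.v *)
Require Import Defs.
From mathcomp Require Import ring lra.

(** The argument is a Lyapunov analysis.  Write d_k = x^k - x^(k-1), g_k for
    the gradient at x^k, and
      xi_k = f(x^k) - min f + delta_k |d_k|^2,
      theta = (1 - c) L / (4 c) = 1/2 ((1 - beta_k) / gamma_k - L / 2),
    where theta does not depend on k because (1 - beta_k) / gamma_k = L / (2c).

    Descent.  The recursion gives gamma_k g_k = beta_k d_k - d_(k+1).  Inserting
    this into the quadratic upper bound of a function with L-Lipschitz gradient
    and using 2 <d_k, d_(k+1)> <= |d_k|^2 + |d_(k+1)|^2 yields
      f(x^(k+1)) + (delta_k + theta) |d_(k+1)|^2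
        <= f(x^k) + (delta_k - theta) |d_k|^2.
    Since delta_k = 1 / (2 gamma_k) - L / 4 is nonincreasing, it follows that
      theta (|d_k|^2 + |d_(k+1)|^2) <= xi_k - xi_(k+1)
    ([hb_energy_decrease]).  In particular the values f(x^k) stay bounded
    above, so by coercivity the iterates stay bounded: the radius R is finite.

    Gap.  By convexity f(x^k) - min f <= <g_k, x^k - x*>, so
      xi_k <= (beta_k |d_k| + |d_(k+1)|) |x^k - x*| / gamma_k
              + delta_k |d_k|^2.
    For k >= 1 both x^k and x^(k-1) lie within sqrt R of x*, hence
    |d_k| <= 2 sqrt R.  Squaring with Cauchy-Schwarz and using
    delta_k <= 1 / (2 gamma_k), beta_k <= 1 to absorb the coefficient of |d_k|
    gives, with the announced constant 4,
      xi_k^2 <= 4 R (delta_k^2 + 1 / gamma_k^2) (|d_k|^2 + |d_(k+1)|^2)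
             <= 4 R eps_k (xi_k - xi_(k+1)),
    because eps_k = (delta_k^2 + 1 / gamma_k^2) / theta ([gap_sqr_le],
    [hb_gap_sqr_le]).

    Rate.  A nonnegative sequence with xi_k^2 <= C (xi_k - xi_(k+1)) for k >= 1
    satisfies xi_k <= C / k ([quadratic_decrease_rate]).  Starting at k = 1
    matters: x^(-1) is arbitrary, so R does not control d_0. *)

Local Open Scope classical_set_scope.
Local Open Scope ring_scope.
Local Open Scope convex_scope.

Set Implicit Arguments.
Unset Strict Implicit.
Unset Printing Implicit Defensive.

(** * Euclidean geometry of row vectors *)

Section Euclidean.
Context {R : realType} {m : nat}.
Implicit Types (u v w : 'rV[R]_m) (a : R).

Definition dot u v : R := \sum_i u 0 i * v 0 i.

Lemma dotC u v : dot u v = dot v u.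
Proof. by apply: eq_bigr => i _; rewrite mulrC. Qed.

Lemma dotDl u v w : dot (u + v) w = dot u w + dot v w.
Proof. by rewrite -big_split; apply: eq_bigr => i _ /=; rewrite mxE mulrDl. Qed.

Lemma dotDr u v w : dot u (v + w) = dot u v + dot u w.
Proof. by rewrite dotC dotDl !(dotC u). Qed.

Lemma dotZl a u v : dot (a *: u) v = a * dot u v.
Proof. by rewrite mulr_sumr; apply: eq_bigr => i _; rewrite mxE mulrA. Qed.

Lemma dotZr a u v : dot u (a *: v) = a * dot u v.
Proof. by rewrite dotC dotZl dotC. Qed.

Lemma dotNl u v : dot (- u) v = - dot u v.
Proof. by rewrite -scaleN1r dotZl mulN1r. Qed.

Lemma dotNr u v : dot u (- v) = - dot u v.
Proof. by rewrite dotC dotNl dotC. Qed.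

Definition dotE := (dotDl, dotDr, dotNl, dotNr, dotZl, dotZr).

Lemma dot_ge0 u : 0 <= dot u u.
Proof. by apply: sumr_ge0 => i _; rewrite -expr2 sqr_ge0. Qed.

Lemma enorm_ge0 u : 0 <= enorm u.
Proof. exact: sqrtr_ge0. Qed.

Lemma enorm_sqr u : enorm u ^+ 2 = dot u u.
Proof. by rewrite sqr_sqrtr ?sumr_ge0// => i _; rewrite sqr_ge0. Qed.

Lemma cauchy_schwarz u v : dot u v <= enorm u * enorm v.
Proof.
have [v0|vN0] := eqVneq (dot v v) 0.
  have /eqP := v0; rewrite psumr_eq0; last by move=> i _; rewrite -expr2 sqr_ge0.
  move=> /allP vi0; rewrite [dot u v]big1 ?mulr_ge0 ?enorm_ge0// => i _.
  by have := vi0 i (mem_index_enum i); rewrite mulf_eq0 orbb => /eqP ->; rewrite mulr0.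
have v_gt0 : 0 < dot v v by rewrite lt_neqAle eq_sym vN0 dot_ge0.
(* This vector has squared norm |v|^2 (|u|^2 |v|^2 - <u, v>^2). *)
have := dot_ge0 (dot v v *: u - dot u v *: v).
rewrite !dotE (dotC v u) => uv_ge0.
have : dot u v ^+ 2 <= (enorm u * enorm v) ^+ 2.
  rewrite exprMn !enorm_sqr -(ler_pM2l v_gt0); nra.
have uv0 : 0 <= enorm u * enorm v by rewrite mulr_ge0 ?enorm_ge0.
by move=> uv_le; have [//|?] := leP (dot u v) (enorm u * enorm v); nra.
Qed.

Lemma enormZ a u : enorm (a *: u) = `|a| * enorm u.
Proof.
apply/eqP; rewrite -(eqrXn2 (n := 2))// ?mulr_ge0 ?enorm_ge0//.
by rewrite exprMn !enorm_sqr !dotE mulrA real_normK ?num_real.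
Qed.

Lemma enorm_leB u v : enorm (u - v) <= enorm u + enorm v.
Proof.
rewrite -ler_sqr ?nnegrE ?addr_ge0 ?enorm_ge0// sqrrD !enorm_sqr !dotE (dotC v u).
have := cauchy_schwarz (- u) v.
by rewrite dotNl -(scaleN1r u) enormZ normrN1 mul1r; lra.
Qed.

(** This comparison of the sup norm with the Euclidean one turns Euclidean
    boundedness into the boundedness that characterizes compactness. *)
Lemma norm_le_enorm u : `|u| <= enorm u.
Proof.
rewrite [leLHS]/Num.norm /= mx_normrE; apply/bigmax_leP; split; first exact: enorm_ge0.
case=> i j _ /=; rewrite ord1 -sqrtr_sqr ler_wsqrtr// (bigD1 j)//=.
by rewrite lerDl sumr_ge0// => k _; rewrite sqr_ge0.
Qed.

End Euclidean.

(** * First-order bounds for smooth convex functions *)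

Section SmoothConvex.
Context {R : realType} {m : nat}.
Implicit Types (f : 'rV[R]_m -> R) (u v d : 'rV[R]_m).

Lemma derive_grad f v d : differentiable f v -> 'D_d f v = dot (grad f v) d.
Proof.
move=> fv; rewrite deriveE// {1}(row_sum_delta d) linear_sum; apply: eq_bigr => i _.
by rewrite linearZ mxE deriveE// mulrC.
Qed.

Lemma is_derive_line f v d (t : R) : differentiable f (v + t *: d) ->
  is_derive t (1 : R) (fun s : R => f (v + s *: d)) (dot (grad f (v + t *: d)) d).
Proof.
move=> fv; have := @diff_derivable _ _ _ f _ d fv.
have E : (fun h : R => h^-1 *:
    (((fun s : R => f (v + s *: d)) \o shift t) (h *: (1 : R)) - f (v + t *: d)))
  = (fun h : R => h^-1 *: ((f \o shift (v + t *: d)) (h *: d) - f (v + t *: d))).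
  apply/funext => h /=.
  have -> : h *: (1 : R) = h by exact: mulr1.
  by rewrite scalerDl addrCA.
move=> dfv; apply: DeriveDef.
  by rewrite /derivable E.
by rewrite -(derive_grad d fv) /derive E.
Qed.

(** The mean value theorem applied along the segment from u to u + d to f minus
    its quadratic upper model: the Lipschitz bound makes the derivative of this
    difference nonpositive. *)
Lemma descent_lemma f (L : R) : (forall v, differentiable f v) -> lipschitz_grad L f ->
  forall u d, f (u + d) <= f u + dot (grad f u) d + L / 2 * enorm d ^+ 2.
Proof.
move=> fd fL u d.
(* phi 1 <= phi 0 is the claim. *)
pose phi (t : R) :=
  f (u + t *: d) - t * dot (grad f u) d - t ^+ 2 * (L / 2 * enorm d ^+ 2).
pose dphi (t : R) := dot (grad f (u + t *: d)) d - dot (grad f u) d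
  - 2 * t * (L / 2 * enorm d ^+ 2).
have phid (t : R) : is_derive t 1 phi (dphi t).
  have dline := is_derive_line (fd (u + t *: d)).
  rewrite /phi; apply: is_derive_eq.
  rewrite /dphi /GRing.scale /=.
  by rewrite ?expr1 ?mulr0 ?add0r ?mulr1 ?scaler0; ring.
have phi_cont : {within `[0, 1], continuous phi}.
  by apply: derivable_within_continuous => t _; exact: ex_derive.
have [t] := MVT ltr01 (fun t _ => phid t) phi_cont.
rewrite in_itv /= => /andP[t0 t1].
rewrite /phi /dphi !scale0r addr0 scale1r subr0 mulr1 => E.
have := cauchy_schwarz (grad f (u + t *: d) - grad f u) d.
have := fL (u + t *: d) u.
have -> : enorm (u + t *: d - u) = t * enorm d.
  by rewrite addrAC subrr add0r enormZ ger0_norm// ltW.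
rewrite !dotE => h1 h2.
have := ler_wpM2r (enorm_ge0 d) h1.
nra.
Qed.

(** Convexity bounds every forward difference quotient at v in the direction
    u - v by f u - f v; let the step tend to 0 from the right. *)
Lemma convex_gradient f v : convex_function [set: convex_lmodType 'rV[R]_m] f ->
  differentiable f v -> forall u, f v + dot (grad f v) (u - v) <= f u.
Proof.
move=> fc fv u; rewrite -lerBrDl -derive_grad//.
have dfv := @diff_derivable _ _ _ f _ (u - v) fv.
rewrite /derive cvg_at_rightE//; apply: limr_le.
  rewrite -(cvg_at_rightE (fun h : R => h^-1 *: ((f \o shift v) _ - f v)))//.
  apply: cvg_trans dfv; apply: cvg_app => A [e e0 Ae].
  by exists e => // t te /lt0r_neq0; exact: Ae.
near=> t.
have t0 : 0 < t by near: t; exact: nbhs_right_gt.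
have t1 : t <= 1 by near: t; exact: nbhs_right_le.
rewrite /GRing.scale /= ler_pdivrMl// lerBlDr.
have := fc (Itv01 (ltW t0) t1) u v.
rewrite !inE => /(_ I I); rewrite convRE /=.
have -> : (u : convex_lmodType 'rV[R]_m) <| Itv01 (ltW t0) t1 |> v = t *: (u - v) + v.
  rewrite /conv /= /unstable.onem scalerBr scalerBl scale1r.
  by rewrite [RHS]addrAC addrA.
rewrite /unstable.onem mulrBl mul1r => fc_t; apply: le_trans fc_t _.
by rewrite mulrBr addrAC addrA.
Unshelve. all: by end_near. Qed.

End SmoothConvex.

(** * Minimizers and finite suprema *)

(** A sublevel set of a coercive function is compact, and a minimizer over the
    sublevel set of f 0 is a global one. *)
Lemma coercive_argmin (R : realType) m (f : 'rV[R]_m -> R) :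
  continuous f -> coercive f -> exists xs, argmin f xs.
Proof.
move=> fcont fcoer; have [B fB] := fcoer (f 0).
pose K := [set v | f v <= f 0].
have K0 : K !=set0 by exists 0; rewrite /K /=.
have Kclosed : closed K.
  rewrite (_ : K = f @^-1` [set y | y <= f 0])//.
  by apply: preimage_closed (@closed_le _ _) => v _; exact: fcont.
have Kbounded : bounded_set K.
  exists B; split; first exact: num_real.
  move=> M BM v /= Kv; apply: le_trans (norm_le_enorm v) _.
  by rewrite leNgt; apply/negP => /(lt_trans BM)/fB; rewrite ltNge Kv.
have [xs _ fxs] := EVT_min_rV K0 (bounded_closed_compact Kbounded Kclosed)
  (continuous_subspaceT fcont).
exists xs => u; have [uK|/ltW uK] := leP (f u) (f 0); first by apply: fxs; rewrite inE.
by apply: le_trans uK; apply: fxs; rewrite inE /K /=.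
Qed.

Lemma minval_argmin (R : realType) m (f : 'rV[R]_m -> R) xs :
  argmin f xs -> minval f = (f xs)%:E.
Proof.
move=> xs_min; apply/eqP; rewrite eq_le; apply/andP; split.
  by apply: ereal_inf_lbound; exists xs.
by apply: le_ereal_inf_tmp => _ [v _ <-]; rewrite lee_fin.
Qed.

Lemma ereal_sup_fin_num (R : realType) (S : set \bar R) (a b : R) :
  S a%:E -> (forall y, S y -> (y <= b%:E)%E) -> ereal_sup S \is a fin_num.
Proof.
move=> Sa Sb; rewrite fin_numElt; apply/andP; split.
  by apply: lt_le_trans (ereal_sup_ubound Sa); rewrite ltNyr.
by apply: le_lt_trans (ltry b); exact: ge_ereal_sup.
Qed.

(** * Two real inequalities *)

(** By induction: if a (k+1) exceeded C / (k+1), then so would a k, and hence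
    a (k+1) <= a k (1 - a k / C) <= (C / k) (1 - 1 / (k+1)) = C / (k+1). *)
Lemma quadratic_decrease_rate (R : realFieldType) (a : nat -> R) (C : R) :
  (forall k, 0 <= a k) ->
  (forall k, (1 <= k)%N -> a k ^+ 2 <= C * (a k - a k.+1)) -> 0 <= C ->
  forall k, (1 <= k)%N -> k%:R * a k <= C.
Proof.
move=> a_ge0 a_dec C_ge0; elim=> [//|[|k] IH] _.
  rewrite mul1r leNgt; apply/negP => Ca.
  have := a_dec 1%N isT; have := mulr_ge0 C_ge0 (a_ge0 2%N); have := a_ge0 1%N. nra.
have {}IH := IH isT.
have := a_dec k.+1 isT; have := a_ge0 k.+2; have := a_ge0 k.+1.
rewrite -(natr1 k.+1); have : (0 : R) <= k.+1%:R by rewrite ler0n.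
move: IH; set n : R := k.+1%:R; set u := a k.+1; set v := a k.+2 => nu n0 u0 v0 uv.
rewrite leNgt; apply/negP => Cv.
(* If C = 0, the hypothesis at k.+2 already forces v = 0. *)
have C0 : 0 < C.
  rewrite lt_neqAle C_ge0 andbT; apply/eqP => C0.
  have : v ^+ 2 <= 0 by rewrite -[leRHS](mul0r (v - a k.+3)) C0; exact: a_dec.
  by rewrite -C0 in Cv; nra.
have uv_le : v <= u by rewrite -subr_ge0 -(pmulr_rge0 _ C0); nra.
have Cu : C <= (n + 1) * u by apply: le_trans (ltW Cv) _; rewrite ler_wpM2l// addr_ge0.
have : C * (n * u) <= C * C by rewrite ler_pM2l.
have : u * C <= u * ((n + 1) * u) by rewrite ler_wpM2l.
have : (n + 1) * u ^+ 2 <= (n + 1) * (C * (u - v)) by rewrite ler_wpM2l ?addr_ge0.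
have : C * C < C * ((n + 1) * v) by rewrite ltr_pM2l.
lra.
Qed.

(** The inequality that fixes the constant 4.  Replacing p by rho and one factor
    a of a^2 by 2 rho gives xi <= rho ((s beta + 2 delta) a + s b).  The
    hypotheses delta <= s / 2 and beta <= 1 give
    (s beta + 2 delta)^2 <= 3 s^2 + 4 delta^2, so Cauchy-Schwarz yields the
    factor (3 s^2 + 4 delta^2) + s^2.  It is used with s = 1 / gamma_k and
    with a, b, p the norms of d_k, d_(k+1) and x^k - x*. *)
Lemma gap_sqr_le (R : realFieldType) (a b p s beta delta rho xi : R) :
  0 <= a -> 0 <= b -> 0 <= p -> p <= rho -> a <= 2 * rho ->
  0 <= beta -> beta <= 1 -> 0 <= delta -> delta <= s / 2 ->
  0 <= xi -> xi <= s * (beta * a + b) * p + delta * a ^+ 2 ->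
  xi ^+ 2 <= 4 * rho ^+ 2 * (delta ^+ 2 + s ^+ 2) * (a ^+ 2 + b ^+ 2).
Proof.
move=> a0 b0 p0 prho arho beta0 beta1 delta0 deltas xi0 xi_le.
have s0 : 0 <= s by lra.
have rho0 : 0 <= rho by lra.
set t := s * beta + 2 * delta.
have xi_rho : xi <= rho * (t * a + s * b).
  apply: le_trans xi_le _; rewrite /t.
  have h1 : s * (beta * a + b) * p <= s * (beta * a + b) * rho.
    by apply: ler_wpM2l => //; rewrite mulr_ge0// addr_ge0// mulr_ge0.
  have h2 : delta * a * a <= delta * a * (2 * rho).
    by apply: ler_wpM2l => //; rewrite mulr_ge0.
  rewrite expr2 mulrA; lra.
have t_le : t ^+ 2 <= 3 * s ^+ 2 + 4 * delta ^+ 2.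
  rewrite /t.
  have h1 : s ^+ 2 * beta ^+ 2 <= s ^+ 2 by rewrite ler_piMr ?sqr_ge0// expr_le1.
  have h2 : s * beta * delta <= s * (s / 2).
    by rewrite -mulrA ler_wpM2l// (le_trans _ deltas)// ler_piMl.
  lra.
have xi2 : xi ^+ 2 <= rho ^+ 2 * (t * a + s * b) ^+ 2.
  by rewrite -exprMn ler_sqr ?nnegrE ?(le_trans xi0 xi_rho).
apply: le_trans xi2 _.
have cs : (t * a + s * b) ^+ 2 <= (t ^+ 2 + s ^+ 2) * (a ^+ 2 + b ^+ 2).
  by rewrite -subr_ge0 (_ : _ - _ = (t * b - s * a) ^+ 2) ?sqr_ge0//; ring.
rewrite (mulrC 4) -(mulrA (rho ^+ 2)) -(mulrA (rho ^+ 2)).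
apply: ler_wpM2l; first exact: sqr_ge0.
apply: le_trans cs _; apply: ler_wpM2r; last by lra.
by rewrite addr_ge0 ?sqr_ge0.
Qed.

(** * One step of the iteration *)

Section HeavyBallStep.
Context {R : realType} {m : nat}.
Variables (f : 'rV[R]_m -> R) (L gamma beta : R) (x0 x1 x2 : 'rV[R]_m).
Hypotheses (gamma_gt0 : 0 < gamma) (beta_ge0 : 0 <= beta).
Hypothesis x2E : x2 = x1 - gamma *: grad f x1 + beta *: (x1 - x0).

Lemma hb_gradE : grad f x1 = gamma^-1 *: (beta *: (x1 - x0) - (x2 - x1)).
Proof.
apply: (scalerI (lt0r_neq0 gamma_gt0)); rewrite scalerA mulfV ?lt0r_neq0// scale1r x2E.
by rewrite addrAC (addrAC x1) subrr add0r opprD opprK addrCA subrr addr0.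
Qed.

(** The cross term of the momentum is split evenly between the two increments by
    0 <= |d1 - d2|^2, d1 = x1 - x0 and d2 = x2 - x1. *)
Lemma hb_step_descent : (forall v, differentiable f v) -> lipschitz_grad L f ->
  f x2 + (beta / (2 * gamma) + ((1 - beta) / gamma - L / 2)) * enorm (x2 - x1) ^+ 2
  <= f x1 + beta / (2 * gamma) * enorm (x1 - x0) ^+ 2.
Proof.
move=> fd fL; have := descent_lemma fd fL x1 (x2 - x1).
rewrite addrC subrK hb_gradE.
move: (x2 - x1) (x1 - x0) => d2 d1.
have := dot_ge0 (d1 - d2); rewrite !dotE (dotC d2 d1) !enorm_sqr.
have s0 : 0 < gamma^-1 by rewrite invr_gt0.
rewrite invfM; set s := gamma^-1 in s0 *.
move=> d12 fx2.
have : 0 <= beta * s * (dot d1 d1 + - dot d1 d2 + (- dot d1 d2 - - dot d2 d2)).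
  by rewrite mulr_ge0// mulr_ge0// ltW.
move: fx2; nra.
Qed.

Lemma hb_gap_le xs : convex_function [set: convex_lmodType 'rV[R]_m] f ->
  differentiable f x1 ->
  f x1 - f xs <=
    gamma^-1 * (beta * enorm (x1 - x0) + enorm (x2 - x1)) * enorm (x1 - xs).
Proof.
move=> fc fd; have := convex_gradient fc fd xs.
rewrite -(opprB x1 xs) dotNr => fgap.
apply: (@le_trans _ _ (dot (grad f x1) (x1 - xs))); first lra.
rewrite hb_gradE dotZl -mulrA ler_pM2l ?invr_gt0//.
move: (x2 - x1) (x1 - x0) (x1 - xs) => d2 d1 e.
have := cauchy_schwarz (- d2) e; rewrite -(scaleN1r d2) enormZ normrN1 mul1r.
have := ler_wpM2l beta_ge0 (cauchy_schwarz d1 e).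
rewrite !dotE; lra.
Qed.

End HeavyBallStep.

(** * The coefficients of the method *)

Section Coefficients.
Context {R : realType}.
Variables (c L : R) (beta gamma : nat -> R).
Hypotheses (L_gt0 : 0 < L) (c_range : 0 < c < 1).
Hypotheses (beta_range : forall k, 0 < beta k < 1).
Hypothesis beta_noninc : nonincreasing_seq beta.
Hypothesis gammaE : forall k, gamma k = stepsize c L beta k.

(** The factor theta in the decrease of the energy.  This form is half of
    (1 - beta_k) / gamma_k - L / 2; [decrease_rateE] gives the form that appears
    in eps_k. *)
Definition decrease_rate : R := 2^-1 * (L / (2 * c) - L / 2).

Lemma decrease_rateE : decrease_rate = (1 - c) * L / (4 * c).
Proof. by move: c_range => /andP[c0 _]; rewrite /decrease_rate; field; lra. Qed.

Lemma decrease_rate_gt0 : 0 < decrease_rate.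
Proof.
move: c_range => /andP[c0 c1].
by rewrite decrease_rateE divr_gt0 ?mulr_gt0 ?subr_gt0.
Qed.

Lemma stepsize_gt0 k : 0 < gamma k.
Proof.
move: c_range (beta_range k) => /andP[c0 _] /andP[_ b1].
by rewrite gammaE divr_gt0 ?mulr_gt0 ?subr_gt0.
Qed.

Lemma stepsizeV_noninc k l : (k <= l)%N -> (gamma l)^-1 <= (gamma k)^-1.
Proof.
move=> kl; rewrite lef_pV2 ?posrE ?stepsize_gt0// !gammaE.
move: c_range => /andP[c0 _].
rewrite ler_pM2r ?invr_gt0// ler_pM2r// ler_pM2l// lerB//.
exact: beta_noninc.
Qed.

Lemma stepsize_ratio k : (1 - beta k) / gamma k = L / (2 * c).
Proof.
move: c_range (beta_range k) => /andP[c0 _] /andP[_ b1].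
by rewrite gammaE /stepsize; field; rewrite !gt_eqF ?subr_gt0.
Qed.

Lemma hb_delta_decrease_rate k :
  hb_delta L gamma beta k = beta k / (2 * gamma k) + decrease_rate.
Proof. by rewrite /hb_delta stepsize_ratio. Qed.

(** Here beta_k cancels, so that delta_k varies with k only through gamma_k;
    this gives both the monotonicity of delta_k and delta_k <= 1 / (2 gamma_k). *)
Lemma hb_delta_stepsize k : hb_delta L gamma beta k = (gamma k)^-1 / 2 - L / 4.
Proof.
by rewrite /hb_delta; field; rewrite gt_eqF ?stepsize_gt0.
Qed.

Lemma hb_delta_ge0 k : 0 <= hb_delta L gamma beta k.
Proof.
move: (beta_range k) => /andP[b0 _].
rewrite hb_delta_decrease_rate addr_ge0 ?(ltW decrease_rate_gt0)//.
by rewrite divr_ge0 ?(ltW b0)// mulr_ge0 ?(ltW (stepsize_gt0 k)).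
Qed.

Lemma hb_delta_nonincreasing k l : (k <= l)%N ->
  hb_delta L gamma beta l <= hb_delta L gamma beta k.
Proof. by move=> /stepsizeV_noninc; rewrite !hb_delta_stepsize; lra. Qed.

Lemma hb_epsE k : hb_eps c L gamma beta k =
  (hb_delta L gamma beta k ^+ 2 + (gamma k)^-1 ^+ 2) / decrease_rate.
Proof.
move: c_range => /andP[c0 c1]; rewrite decrease_rateE /hb_eps; field.
by rewrite !gt_eqF ?subr_gt0 ?stepsize_gt0.
Qed.

(** Both delta_k and 1 / gamma_k are nonincreasing, so the supremum of eps_k is
    attained at k = 0. *)
Lemma hb_eps_le_first k : hb_eps c L gamma beta k <= hb_eps c L gamma beta 0.
Proof.
rewrite !hb_epsE ler_pM2r ?invr_gt0 ?decrease_rate_gt0//.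
have s0 l : 0 <= (gamma l)^-1 by rewrite invr_ge0 ltW ?stepsize_gt0.
by rewrite lerD// ler_sqr ?nnegrE ?hb_delta_ge0 ?hb_delta_nonincreasing ?stepsizeV_noninc.
Qed.

Lemma hb_eps_ge0 k : 0 <= hb_eps c L gamma beta k.
Proof. by rewrite hb_epsE divr_ge0 ?(ltW decrease_rate_gt0)// addr_ge0 ?sqr_ge0. Qed.

Lemma hb_sup_eps_fin_num : hb_sup_eps c L gamma beta \is a fin_num.
Proof.
apply: (ereal_sup_fin_num (a := hb_eps c L gamma beta 0) (b := hb_eps c L gamma beta 0)).
  by exists 0%N.
by move=> _ [k _ <-]; rewrite lee_fin hb_eps_le_first.
Qed.

(** * Convergence of the iteration *)

Section Iteration.
Context {m : nat}.
Variables (f : 'rV[R]_m -> R) (xm1 : 'rV[R]_m) (x : nat -> 'rV[R]_m).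
Hypothesis f_convex : convex_function [set: convex_lmodType 'rV[R]_m] f.
Hypothesis f_diff : forall v, differentiable f v.
Hypothesis f_lip : lipschitz_grad L f.
Hypothesis f_coercive : coercive f.
Hypothesis x_hb : heavy_ball f gamma beta xm1 x.

Definition hb_inc k : R := enorm (x k - prev xm1 x k).

(** The Lyapunov function, up to the constant min f. *)
Definition hb_energy k : R := f (x k) + hb_delta L gamma beta k * hb_inc k ^+ 2.

Lemma f_le_hb_energy k : f (x k) <= hb_energy k.
Proof. by rewrite lerDl mulr_ge0 ?sqr_ge0 ?hb_delta_ge0. Qed.

(** The one-step descent inequality carries weights delta_k + theta and
    delta_k - theta; passing from delta_k to the smaller delta_(k+1) on the new
    increment turns it into a difference of energies. *)
Lemma hb_energy_decrease k :
  decrease_rate * (hb_inc k ^+ 2 + hb_inc k.+1 ^+ 2) <= hb_energy k - hb_energy k.+1.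
Proof.
have /andP[/ltW b0 _] := beta_range k.
have := hb_step_descent (stepsize_gt0 k) b0 (x_hb k) f_diff f_lip.
rewrite stepsize_ratio; have := hb_delta_decrease_rate k.
have := ler_wpM2r (sqr_ge0 (hb_inc k.+1)) (hb_delta_nonincreasing (leqnSn k)).
rewrite /hb_energy /= -/(hb_inc k) -[enorm (x k.+1 - x k)]/(hb_inc k.+1) /decrease_rate.
move: (hb_delta _ _ _ _) (hb_delta _ _ _ _) => d1 d0 d10 d0E.
rewrite d0E in d10 *; move: d10; lra.
Qed.

Lemma hb_energy_nonincreasing k : hb_energy k <= hb_energy 0.
Proof.
elim: k => // k; apply: le_trans; rewrite -subr_ge0.
apply: le_trans (hb_energy_decrease k).
by rewrite mulr_ge0 ?(ltW decrease_rate_gt0)// addr_ge0 ?sqr_ge0.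
Qed.

(** All iterates and all minimizers lie in the sublevel set of the initial
    energy, which coercivity confines to a Euclidean ball of radius B. *)
Lemma hb_radius_fin_num : hb_radius f x \is a fin_num.
Proof.
have [xs xs_min] :=
  coercive_argmin (fun v => differentiable_continuous (f_diff v)) f_coercive.
have [B fB] := f_coercive (hb_energy 0).
have in_ball v : f v <= hb_energy 0 -> enorm v <= B.
  by move=> fv; rewrite leNgt; apply/negP => /fB; rewrite ltNge fv.
have dist_le k y : argmin f y -> enorm (x k - y) ^+ 2 <= (B + B) ^+ 2.
  move=> y_min.
  have xB : enorm (x k) <= B.
    exact/in_ball/(le_trans (f_le_hb_energy k))/hb_energy_nonincreasing.
  have yB : enorm y <= B.
    exact/in_ball/(le_trans (y_min (x 0%N)))/f_le_hb_energy.
  have B0 := le_trans (enorm_ge0 y) yB.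
  rewrite ler_sqr ?nnegrE ?enorm_ge0 ?addr_ge0//.
  exact: le_trans (enorm_leB _ _) (lerD xB yB).
pose inner k := ereal_sup [set (enorm (x k - y) ^+ 2)%:E | y in argmin f].
have inner_fin k : inner k \is a fin_num.
  apply: (ereal_sup_fin_num (a := enorm (x k - xs) ^+ 2) (b := (B + B) ^+ 2)).
    by exists xs.
  by move=> _ [y y_min <-]; rewrite lee_fin dist_le.
apply: (ereal_sup_fin_num (a := fine (inner 0%N)) (b := (B + B) ^+ 2)).
  by exists 0%N => //; rewrite fineK.
move=> _ [k _ <-]; apply: ge_ereal_sup => _ [y y_min <-].
by rewrite lee_fin dist_le.
Qed.

Lemma hb_dist_le k xs : argmin f xs ->
  enorm (x k - xs) ^+ 2 <= fine (hb_radius f x).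
Proof.
move=> xs_min; rewrite -lee_fin fineK ?hb_radius_fin_num//.
apply: (@le_trans _ _ (ereal_sup [set (enorm (x k - y) ^+ 2)%:E | y in argmin f])).
  by apply: ereal_sup_ubound; exists xs.
by apply: ereal_sup_ubound; exists k.
Qed.

(** For k >= 1 the triangle inequality through xs bounds the increment at k by
    twice the square root of the radius, which is what [gap_sqr_le] requires. *)
Lemma hb_gap_sqr_le k xs : argmin f xs -> (1 <= k)%N ->
  (hb_energy k - f xs) ^+ 2 <=
    4 * fine (hb_radius f x) * hb_eps c L gamma beta k * (hb_energy k - hb_energy k.+1).
Proof.
move=> xs_min k1; set r := fine (hb_radius f x).
have r0 : 0 <= r by apply: le_trans (hb_dist_le 0 xs_min); exact: sqr_ge0.
have dist_le l : enorm (x l - xs) <= Num.sqrt r.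
  rewrite -[leLHS]ger0_norm ?enorm_ge0// -sqrtr_sqr ler_wsqrtr//.
  exact: hb_dist_le.
have /andP[b0 b1] := beta_range k.
have inc_le : hb_inc k <= 2 * Num.sqrt r.
  case: k k1 {b0 b1} => // k _; rewrite /hb_inc /=.
  rewrite (_ : x k.+1 - x k = (x k.+1 - xs) - (x k - xs)); last first.
    by rewrite opprB addrA subrK.
  apply: le_trans (enorm_leB _ _) _.
  by rewrite mulr_natl mulr2n lerD.
have gap := hb_gap_le (stepsize_gt0 k) (ltW b0) (x_hb k) xs f_convex (f_diff _).
have := @gap_sqr_le _ (hb_inc k) (hb_inc k.+1) (enorm (x k - xs)) (gamma k)^-1
  (beta k) (hb_delta L gamma beta k) (Num.sqrt r) (hb_energy k - f xs).
rewrite (sqr_sqrtr r0).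
move=> /(_ (enorm_ge0 _) (enorm_ge0 _) (enorm_ge0 _) (dist_le k) inc_le).
move=> /(_ (ltW b0) (ltW b1) (hb_delta_ge0 k)).
have delta_le : hb_delta L gamma beta k <= (gamma k)^-1 / 2.
  by rewrite hb_delta_stepsize; move: L_gt0; lra.
have xi_ge0 : 0 <= hb_energy k - f xs.
  by rewrite subr_ge0 (le_trans (xs_min _) (f_le_hb_energy k)).
move=> /(_ delta_le xi_ge0) gap2; apply: le_trans (gap2 _) _.
  by rewrite /hb_energy addrAC lerD2r; exact: gap.
rewrite hb_epsE mulrA -[leRHS]mulrA.
apply: ler_wpM2l.
  by rewrite mulr_ge0 ?mulr_ge0// addr_ge0 ?sqr_ge0.
by rewrite mulrC ler_pdivlMr ?decrease_rate_gt0// mulrC hb_energy_decrease.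
Qed.

Lemma hb_rate k xs : argmin f xs -> (1 <= k)%N ->
  k%:R * (f (x k) - f xs) <=
    4 * fine (hb_radius f x) * fine (hb_sup_eps c L gamma beta).
Proof.
move=> xs_min k1; set e := fine (hb_sup_eps c L gamma beta).
have eps_le l : hb_eps c L gamma beta l <= e.
  rewrite -lee_fin fineK ?hb_sup_eps_fin_num//.
  by apply: ereal_sup_ubound; exists l.
have r0 : 0 <= fine (hb_radius f x).
  by apply: le_trans (hb_dist_le 0 xs_min); exact: sqr_ge0.
have e0 : 0 <= e := le_trans (hb_eps_ge0 0) (eps_le 0%N).
apply: (@le_trans _ _ (k%:R * (hb_energy k - f xs))).
  by rewrite ler_wpM2l// lerD2r f_le_hb_energy.
apply: (@quadratic_decrease_rate _ (fun l => hb_energy l - f xs)) => //.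
- by move=> l; rewrite subr_ge0 (le_trans (xs_min _) (f_le_hb_energy l)).
- move=> l l1; rewrite opprB addrA subrK; apply: le_trans (hb_gap_sqr_le xs_min l1) _.
  apply: ler_wpM2r; last by rewrite ler_wpM2l// mulr_ge0.
  apply: le_trans (hb_energy_decrease l).
  by rewrite mulr_ge0 ?(ltW decrease_rate_gt0)// addr_ge0 ?sqr_ge0.
- by rewrite !mulr_ge0.
Qed.

End Iteration.
End Coefficients.

Theorem theorem1 (R : realType) (m : nat) (f : 'rV[R]_m -> R) (L c : R)
    (beta gamma : nat -> R) (xm1 : 'rV[R]_m) (x : nat -> 'rV[R]_m)
    (f_convex : convex_function [set: convex_lmodType 'rV[R]_m] f)
    (f_diff : forall v, differentiable f v)
    (f_coercive : coercive f)
    (L_gt0 : 0 < L)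
    (f_lip : lipschitz_grad L f)
    (f_min : (-oo < minval f)%E)
    (beta_noninc : nonincreasing_seq beta)
    (beta_inf : 0 < inf (range beta))
    (beta_bounds : forall k, inf (range beta) <= beta k <= beta 0%N)
    (beta0_lt1 : beta 0%N < 1)
    (c_range : 0 < c < 1)
    (gammaE : forall k, gamma k = stepsize c L beta k)
    (x_hb : heavy_ball f gamma beta xm1 x) :
  [/\ hb_radius f x \is a fin_num,
      hb_sup_eps c L gamma beta \is a fin_num &
      forall k, (1 <= k)%N ->
        ((f (x k))%:E - minval f <=
         4%:E * hb_radius f x * hb_sup_eps c L gamma beta * (k%:R^-1)%:E)%E].
Proof.
have beta_range k : 0 < beta k < 1.
  have /andP[inf_le le0] := beta_bounds k.
  by rewrite (lt_le_trans beta_inf inf_le) (le_lt_trans le0).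
have [xs xs_min] :=
  coercive_argmin (fun v => differentiable_continuous (f_diff v)) f_coercive.
have radius_fin : hb_radius f x \is a fin_num.
  exact: (hb_radius_fin_num L_gt0 c_range beta_range beta_noninc gammaE
    f_diff f_lip f_coercive x_hb).
have eps_fin : hb_sup_eps c L gamma beta \is a fin_num.
  exact: (hb_sup_eps_fin_num L_gt0 c_range beta_range beta_noninc gammaE).
split=> // k k1; rewrite (minval_argmin xs_min) -(fineK radius_fin) -(fineK eps_fin).
rewrite -EFinB -!EFinM lee_fin ler_pdivlMr ?ltr0n// mulrC.
exact: (hb_rate L_gt0 c_range beta_range beta_noninc gammaE
  f_convex f_diff f_lip f_coercive x_hb).
Qed.
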